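(* The problem $$\min_{\mathbf{x}\in\mathcal{X}}\ \max_{\boldsymbol{\xi}\in\Xi}\ \min_{\mathbf{y}\in\mathcal{Y}\cap\mathcal{S}(\mathbf{x})}\ \mathbf{c}^\top\mathbf{x}+\boldsymbol{\xi}^\top\mathbf{y}$$ can be reformulated into the constrained network flow problem $$\begin{aligned}\min_{\mathbf{x},\mathbf{y},\mathbf{z},\boldsymbol{\lambda}}\quad&\mathbf{c}^\top\mathbf{x}+\mathbf{d}^\top\boldsymbol{\lambda}\\ \text{s.t.}\quad&\mathbf{T}^\top\boldsymbol{\lambda}=\mathbf{y},\\ &y_i=\sum_{j\in\mathcal{A}_i^1}z_j\quad\forall i\in\{1,\ldots,n\},\\ &\mathbf{A}\mathbf{z}=\mathbf{b},\\ &\mathbf{y}\in\mathcal{S}(\mathbf{x}),\\ &\mathbf{x}\in\mathcal{X},\ \mathbf{z}\ge\mathbf{0},\ \boldsymbol{\lambda}\ge\mathbf{0},\end{aligned}$$ where $\mathbf{A}$, $\mathbf{b}$ and $\mathcal{A}_i^1$ come from a decision diagram $\mathcal{D}=(\mathcal{V},\mathcal{A})$ representing $\mathcal{Y}$. That is, the two problems have the same optimal value and the same set of optimal first-stage decisions $\mathbf{x}$.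
   Context: Problem data: $m,n$ are positive integers, $\mathbf{c}\in\mathbb{R}^m$, $\mathcal{X}\subseteq\{0,1\}^m$, $\mathcal{Y}=\{\mathbf{y}\in\{0,1\}^n\mid\mathbf{G}\mathbf{y}\ge\mathbf{h}\}$ for a real matrix $\mathbf{G}$ and real vector $\mathbf{h}$, and $\Xi=\{\boldsymbol{\xi}\in\mathbb{R}^n\mid\mathbf{T}\boldsymbol{\xi}\le\mathbf{d}\}$ is a nonempty bounded polyhedron. The problem has selective adaptability: for pairwise disjoint $\mathcal{U}_1,\mathcal{U}_2,\mathcal{U}_3\subseteq\{1,\ldots,n\}\times\{1,\ldots,m\}$, $$\mathcal{S}(\mathbf{x})=\{\mathbf{y}\in\mathbb{R}^n\mid y_i\le x_j\ \forall(i,j)\in\mathcal{U}_1,\ y_i=x_j\ \forall(i,j)\in\mathcal{U}_2,\ y_i\ge x_j\ \forall(i,j)\in\mathcal{U}_3\}.$$ The minimum over an empty (infeasible) set is $+\infty$. A first-stage decision $\mathbf{x}$ is optimal for a problem if the (finite) optimal value of that problem is attained with first-stage decision $\mathbf{x}$. Decision diagram: a directed acyclic (multi)graph $\mathcal{D}=(\mathcal{V},\mathcal{A})$ whose nodes are partitioned into $n+1$ nonempty layers $\mathcal{V}_1,\ldots,\mathcal{V}_{n+1}$ with $\mathcal{V}_1=\{\mathtt{r}\}$ (root) and $\mathcal{V}_{n+1}=\{\mathtt{t}\}$ (terminal); each arc goes from a node of $\mathcal{V}_i$ to a node of $\mathcal{V}_{i+1}$ for some $i\in\{1,\ldots,n\}$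 and carries a label 0 or 1. $\mathcal{A}_i^0,\mathcal{A}_i^1$ are the sets of arcs leaving nodes of $\mathcal{V}_i$ with label 0 and 1, respectively. A path from $\mathtt{r}$ to $\mathtt{t}$ maps to the vector $\mathbf{y}\in\{0,1\}^n$ with $y_i$ equal to the label of its arc leaving layer $i$. $\mathcal{D}$ represents $\mathcal{Y}$ if every $\mathtt{r}$–$\mathtt{t}$ path maps to an element of $\mathcal{Y}$ and every element of $\mathcal{Y}$ arises from such a path. Network flow data: $\mathbf{A}\in\{-1,0,1\}^{|\mathcal{V}|\times|\mathcal{A}|}$ is the node-arc incidence matrix (in the column of an arc, entry $-1$ at its tail and $+1$ at its head), and $\mathbf{b}$ is zero except for the entry $-1$ at $\mathtt{r}$ and the entry $1$ at $\mathtt{t}$; so $\mathbf{A}\mathbf{z}=\mathbf{b}$ is conservation of one unit of flow from $\mathtt{r}$ to $\mathtt{t}$. *)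

(* Defs.v *)
From HB Require Import structures.
From mathcomp Require Import all_boot all_order all_algebra.
From mathcomp Require Import all_classical all_reals all_analysis.
Set Implicit Arguments.
Unset Strict Implicit.
Unset Printing Implicit Defensive.
Import Order.TTheory GRing.Theory Num.Theory.
Import numFieldNormedType.Exports.
Local Open Scope classical_set_scope.
Local Open Scope ring_scope.

Definition dotp (R : realType) (n : nat) (u v : 'cV[R]_n) : R :=
  (u^T *m v) 0 0.

Definition vec_le (R : realType) (n : nat) (u v : 'cV[R]_n) : Prop :=
  forall i, u i 0 <= v i 0.

Definition binary_vec (R : realType) (n : nat) : set 'cV[R]_n :=
  [set v : 'cV[R]_n | forall i, v i 0 = 0 \/ v i 0 = 1].

Definition recourse_set (R : realType) (n p : nat)
    (G : 'M[R]_(p, n)) (h : 'cV[R]_p) : set 'cV[R]_n :=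
  [set y : 'cV[R]_n | binary_vec y /\ vec_le h (G *m y)].

Definition polyhedron (R : realType) (n q : nat)
    (T : 'M[R]_(q, n)) (d : 'cV[R]_q) : set 'cV[R]_n :=
  [set xi | vec_le (T *m xi) d].

Definition adaptable_set (R : realType) (m n : nat)
    (U1 U2 U3 : {set 'I_n * 'I_m}) (x : 'cV[R]_m) : set 'cV[R]_n :=
  [set y : 'cV[R]_n |
    [/\ forall i j, (i, j) \in U1 -> y i 0 <= x j 0,
        forall i j, (i, j) \in U2 -> y i 0 = x j 0
      & forall i j, (i, j) \in U3 -> y i 0 >= x j 0]].

(* Layers are numbered from 0 to n, so that the decision variable indexed by
   i : 'I_n is decided on the arcs leaving layer i. Distinct arcs may have the
   same endpoints and label. Acyclicity follows from dd_arc_layer. *)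
Record decision_diagram (n : nat) := DecisionDiagram {
  dd_node : finType;
  dd_arc : finType;
  dd_layer : dd_node -> 'I_n.+1;
  dd_tail : dd_arc -> dd_node;
  dd_head : dd_arc -> dd_node;
  dd_label : dd_arc -> bool;
  dd_root : dd_node;
  dd_terminal : dd_node;
  dd_layer_nonempty : forall i, exists v, dd_layer v = i;
  dd_first_layer : forall v, dd_layer v = ord0 <-> v = dd_root;
  dd_last_layer : forall v, dd_layer v = ord_max <-> v = dd_terminal;
  dd_arc_layer : forall a,
    dd_layer (dd_head a) = (dd_layer (dd_tail a)).+1 :> nat
}.

Fixpoint dd_walk (n : nat) (D : decision_diagram n)
    (u : dd_node D) (p : seq (dd_arc D)) (v : dd_node D) : Prop :=
  if p is a :: p' then dd_tail a = u /\ dd_walk (dd_head a) p' v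
  else u = v.

Definition dd_rt_path (n : nat) (D : decision_diagram n)
    (p : seq (dd_arc D)) : Prop :=
  dd_walk (dd_root D) p (dd_terminal D).

Definition dd_arcs (n : nat) (D : decision_diagram n) (i : 'I_n) (l : bool) :
    {set dd_arc D} :=
  [set a | (dd_layer (dd_tail a) == i :> nat) && (dd_label a == l)].

(* A root-terminal path has exactly one arc leaving each layer i < n, so its
   label there is 1 iff the path contains an arc of [dd_arcs D i true]. *)
Definition dd_path_vec (R : realType) (n : nat) (D : decision_diagram n)
    (p : seq (dd_arc D)) : 'cV[R]_n :=
  \col_i (has (mem (dd_arcs D i true)) p)%:R.

Definition dd_represents (R : realType) (n : nat) (D : decision_diagram n)
    (Y : set 'cV[R]_n) : Prop :=
  (forall p : seq (dd_arc D), dd_rt_path p -> Y (dd_path_vec R p)) /\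
  (forall y, Y y -> exists2 p : seq (dd_arc D), dd_rt_path p &
                      dd_path_vec R p = y).

Definition dd_incidence (R : realType) (n : nat) (D : decision_diagram n) :
    'M[R]_(#|dd_node D|, #|dd_arc D|) :=
  \matrix_(v, a) if enum_val v == dd_tail (enum_val a) then -1
                 else if enum_val v == dd_head (enum_val a) then 1
                 else 0.

Definition dd_supply (R : realType) (n : nat) (D : decision_diagram n) :
    'cV[R]_#|dd_node D| :=
  \col_v if enum_val v == dd_root D then -1
         else if enum_val v == dd_terminal D then 1
         else 0.

Section Problems.
Context (R : realType) (m n : nat).
Implicit Types (c x : 'cV[R]_m) (xi y : 'cV[R]_n) (X : set 'cV[R]_m).
Implicit Types (Xi Y : set 'cV[R]_n) (S : 'cV[R]_m -> set 'cV[R]_n).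

(* Extended-real infima give the value +oo to infeasible minimizations. *)
Definition second_stage_value c Y S x xi : \bar R :=
  ereal_inf [set (dotp c x + dotp xi y)%:E | y in Y `&` S x].

Definition worst_case_value c Xi Y S x : \bar R :=
  ereal_sup [set second_stage_value c Y S x xi | xi in Xi].

Definition robust_value c X Xi Y S : \bar R :=
  ereal_inf [set worst_case_value c Xi Y S x | x in X].

Definition robust_optimal c X Xi Y S : set 'cV[R]_m :=
  [set x | [/\ X x, robust_value c X Xi Y S \is a fin_num
             & worst_case_value c Xi Y S x = robust_value c X Xi Y S]].

Context (q : nat).
Implicit Types (T : 'M[R]_(q, n)) (d lam : 'cV[R]_q) (D : decision_diagram n).

Definition flow_feasible X T S D x y (z : 'cV[R]_#|dd_arc D|) lam : Prop :=
  [/\ T^T *m lam = y,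
      forall i, y i 0 = \sum_(a in dd_arcs D i true) z (enum_rank a) 0,
      dd_incidence R D *m z = dd_supply R D,
      S x y
    & [/\ X x, vec_le 0 z & vec_le 0 lam]].

Definition flow_value c X T d S D : \bar R :=
  ereal_inf [set v | exists x y (z : 'cV[R]_#|dd_arc D|) lam,
    flow_feasible X T S x y z lam /\ v = (dotp c x + dotp d lam)%:E].

Definition flow_optimal c X T d S D : set 'cV[R]_m :=
  [set x | exists y (z : 'cV[R]_#|dd_arc D|) lam,
    flow_feasible X T S x y z lam /\
    (dotp c x + dotp d lam)%:E = flow_value c X T d S D].

End Problems.

(* Main.v *)
Require Import Defs.
From HB Require Import structures.
From mathcomp Require Import all_boot all_order all_algebra.
From mathcomp Require Import all_classical all_reals all_analysis.
From mathcomp Require Import ring lra.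
Set Implicit Arguments.
Unset Strict Implicit.
Unset Printing Implicit Defensive.
Import Order.TTheory GRing.Theory Num.Theory.
Import numFieldNormedType.Exports.
Local Open Scope classical_set_scope.
Local Open Scope ring_scope.

(** For a fixed binary [x], the two problems are linked by the convex hull of
    the finite set [Y `&` S x], approached from two sides.

    A feasible flow bounds the worst case from above. Given [xi] in the
    uncertainty set, weak duality and [T^T *m lam = y] give
    [dotp xi y <= dotp d lam], and [dotp xi y] is the cost of the flow [z] when
    every arc with label 1 leaving layer [i] costs [xi i 0]. Shortest-path
    distances in the support of [z], used as node potentials, show that some
    root-terminal path inside the support is at most as expensive as [z]
    ([cheap_support_path]). This path is an element of [Y]; it also belongs to
    [S x] because [x] is binary: each bound of [S x] is either vacuous for a 0/1
    vector, or it forces [y i 0] to the extreme value 0 or 1, in which case all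
    flow through layer [i] uses a single label, and so does any path in the
    support ([support_path_vec]). Hence the inner minimum at [xi] is at most the
    value of the flow ([worst_case_le_flow]).

    Conversely, let [v] be a real upper bound of the worst case, reduced by the
    constant [dotp c x]. For every [xi] in the uncertainty set, some
    root-terminal path with vector in [S x] has cost at most [v]. By linear
    programming duality ([minimax_duality], obtained from Fourier-Motzkin
    elimination [fourier_motzkin]) one fixed convex combination [y] of these
    path vectors has a certificate [lam] with [T^T *m lam = y] and cost at most
    [v]. The same convex combination of the paths is a unit flow
    ([path_flow]), and its vector stays in the convex set [S x]. So the bound [v]
    is attained by a feasible flow ([flow_le_worst_case]).

    Together, the worst case of [x] is the minimum of the flow problem with the
    first stage fixed to [x], attained whenever it is finite; it is never [-oo]
    because [Y] is finite ([worst_case_neqNy]). Equality of the optimal values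
    and of the optimal first stages follows. *)

(** * Dot product *)

Lemma dotpE (R : realType) n (u v : 'cV[R]_n) :
  dotp u v = \sum_i u i 0 * v i 0.
Proof. by rewrite /dotp mxE; apply: eq_bigr => i _; rewrite mxE. Qed.

Lemma dotpC (R : realType) n (u v : 'cV[R]_n) : dotp u v = dotp v u.
Proof. by rewrite !dotpE; apply: eq_bigr => i _; rewrite mulrC. Qed.

Lemma dotpDr (R : realType) n (u v w : 'cV[R]_n) :
  dotp u (v + w) = dotp u v + dotp u w.
Proof. by rewrite /dotp mulmxDr mxE. Qed.

Lemma dotpZr (R : realType) n s (u v : 'cV[R]_n) :
  dotp u (s *: v) = s * dotp u v.
Proof. by rewrite /dotp -scalemxAr mxE. Qed.

Lemma dotpDl (R : realType) n (u v w : 'cV[R]_n) :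
  dotp (u + v) w = dotp u w + dotp v w.
Proof. by rewrite dotpC dotpDr !(dotpC w). Qed.

Lemma dotpZl (R : realType) n s (u v : 'cV[R]_n) :
  dotp (s *: u) v = s * dotp u v.
Proof. by rewrite dotpC dotpZr dotpC. Qed.

Lemma dotp0 (R : realType) n (u : 'cV[R]_n) : dotp u 0 = 0.
Proof. by rewrite /dotp mulmx0 mxE. Qed.

Lemma dotp_mulmx (R : realType) q n (T : 'M[R]_(q, n)) (lam : 'cV[R]_q) xi :
  dotp xi (T^T *m lam) = dotp (T *m xi) lam.
Proof. by rewrite /dotp trmx_mul mulmxA. Qed.

Lemma dotp_delta (R : realType) n (u : 'cV[R]_n) k :
  dotp u (delta_mx k 0) = u k 0.
Proof.
rewrite dotpE (bigD1 k) //= mxE !eqxx mulr1 big1 ?addr0 // => i ik.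
by rewrite mxE (negPf ik) mulr0.
Qed.

Lemma dotp_le2l (R : realType) n (u v w : 'cV[R]_n) :
  vec_le u v -> vec_le 0 w -> dotp u w <= dotp v w.
Proof.
move=> uv w0; rewrite !dotpE; apply: ler_sum => i _.
by apply: ler_wpM2r => //; have := w0 i; rewrite mxE.
Qed.

(** * Linear inequalities *)

Lemma seq_max (R : realType) (K : eqType) (f : K -> R) (s : seq K) :
  s != [::] -> exists2 m, m \in s & {in s, forall x, f x <= f m}.
Proof.
elim: s => // a s IH _; have [->|/IH [m ms mP]] := eqVneq s [::].
  by exists a => [|x]; rewrite inE // => /eqP ->.
have [am|ma] := leP (f a) (f m).
  exists m => [|x]; first by rewrite inE ms orbT.
  by rewrite inE => /predU1P[-> //|/mP].
exists a => [|x]; first by rewrite inE eqxx.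
by rewrite inE => /predU1P[-> //|/mP /le_trans -> //]; exact: ltW.
Qed.

(** The one-variable case of Fourier-Motzkin elimination: the midpoint of the
    largest lower bound and the smallest upper bound works. It respects the
    strict bounds too: if the two extremes coincide, then a strict bound is
    compared strictly with the extreme on the other side, which is the midpoint. *)
Lemma separating_point (R : realType) (K : eqType) (f : K -> R)
    (st : pred K) (L U : seq K) :
  {in L & U, forall l u, f l < f u ?<= if ~~ (st l || st u)} ->
  exists t, {in L, forall l, f l < t ?<= if ~~ st l} /\
            {in U, forall u, t < f u ?<= if ~~ st u}.
Proof.
have [->|/(seq_max f)[l0 l0L l0P]] := eqVneq L [::].
  have [->|/(seq_max (fun u => - f u))[u0 u0U u0P]] := eqVneq U [::].
    by exists 0.
  move=> _; exists (f u0 - 1); split=> // u /u0P; rewrite lerN2 => u0u.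
  by apply: lteifS; lra.
have [->|/(seq_max (fun u => - f u))[u0 u0U u0P]] := eqVneq U [::].
  move=> _; exists (f l0 + 1); split=> // l /l0P ll0.
  by apply: lteifS; lra.
move=> LU; exists ((f l0 + f u0) / 2); split=> [l lL|u uU].
  have := LU _ _ lL u0U; have := l0P _ lL.
  by case: (st l) (st u0) => -[] /=; lra.
have := LU _ _ l0L uU; have := u0P _ uU; rewrite lerN2.
by case: (st u) (st l0) => -[] /=; lra.
Qed.

(** [(a, b, st)] stands for [dotp a xi < b] when [st], and for
    [dotp a xi <= b] otherwise. *)
Definition constraint (R : realType) n := ('cV[R]_n * R * bool)%type.

Definition slack (R : realType) n (k : constraint R n) (xi : 'cV[R]_n) : R :=
  k.1.2 - dotp k.1.1 xi.

Definition sat (R : realType) n (xi : 'cV[R]_n) (k : constraint R n) : bool :=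
  0 < slack k xi ?<= if ~~ k.2.

(** A positive combination of inequalities is strict as soon as one of them is. *)
Definition comb (R : realType) n (s t : R) (k l : constraint R n) :
    constraint R n :=
  (s *: k.1.1 + t *: l.1.1, s * k.1.2 + t * l.1.2, k.2 || l.2).

Lemma slack_comb (R : realType) n s t (k l : constraint R n) xi :
  slack (comb s t k l) xi = s * slack k xi + t * slack l xi.
Proof. by rewrite /slack /= dotpDl !dotpZl; lra. Qed.

Lemma slack_shift (R : realType) n (k : constraint R n) xi t i :
  slack k (xi + t *: delta_mx i 0) = slack k xi - t * k.1.1 i 0.
Proof. by rewrite /slack dotpDr dotpZr dotp_delta; lra. Qed.

(** Motzkin's transposition theorem. An infeasible system has a contradictory
    consequence without variables, [0 < b] or [0 <= b], that is derived by
    positive combinations only. The predicate [K] abstracts the shape of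
    derivable constraints, so that an instance can carry the multipliers in
    whatever form it needs. The variables are eliminated one by one, from the
    last to the first. *)
Lemma fourier_motzkin (R : realType) n (K : constraint R n -> Prop)
    (C : seq (constraint R n)) :
  (forall s t k l, 0 < s -> 0 < t -> K k -> K l -> K (comb s t k l)) ->
  {in C, forall k, K k} ->
  (forall xi, ~~ all (sat xi) C) ->
  exists k, [/\ K k, k.1.1 = 0 & ~~ sat 0 k].
Proof.
move=> Kcomb.
suff elim_last j : (j <= n)%N -> forall C : seq (constraint R n),
    {in C, forall k, K k} ->
    (forall k, k \in C -> forall i : 'I_n, (j <= i)%N -> k.1.1 i 0 = 0) ->
    (forall xi, ~~ all (sat xi) C) ->
    exists k, [/\ K k, k.1.1 = 0 & ~~ sat 0 k].
  move=> CK infeas; apply: (elim_last n (leqnn n) C CK) => // k _ i.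
  by rewrite leqNgt ltn_ord.
elim: j {C} => [_|j IH jn] C CK Csupp infeas.
  have /allPn[k kC ksat] := infeas 0; exists k; split => //; first exact: CK.
  by apply/matrixP => i i'; rewrite ord1 mxE; exact: Csupp.
pose o := Ordinal jn; pose coef (k : constraint R n) := k.1.1 o 0.
pose Z := [seq k <- C | coef k == 0].
pose P := [seq k <- C | 0 < coef k].
pose Q := [seq k <- C | coef k < 0].
(* Normalising the eliminated coefficients to 1 and -1 makes the slack of the
   combination the difference of an upper and a lower bound on the variable. *)
pose pair l u := comb (coef u)^-1 (- coef l)^-1 u l.
have ZP k : k \in Z -> k \in C /\ coef k = 0.
  by rewrite mem_filter => /andP[/eqP].
have PP k : k \in P -> k \in C /\ 0 < coef k.
  by rewrite mem_filter => /andP[].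
have QP k : k \in Q -> k \in C /\ coef k < 0.
  by rewrite mem_filter => /andP[].
apply: (IH (ltnW jn) (Z ++ [seq pair l u | l <- Q, u <- P])).
- move=> k; rewrite mem_cat => /orP[/ZP[/CK] //|].
  case/allpairsP => -[l u] /= [/QP[lC l0] /PP[uC u0] ->].
  by apply: Kcomb; rewrite ?invr_gt0 ?oppr_gt0 //; exact: CK.
- move=> k + i; rewrite leq_eqVlt => + /predU1P[ji|ji].
    have {ji}-> : i = o by exact/val_inj.
    rewrite mem_cat => /orP[/ZP[] //|].
    case/allpairsP => -[l u] /= [/QP[lC l0] /PP[uC u0] ->].
    rewrite !mxE -/(coef u) -/(coef l) mulVf ?gt_eqF //.
    by rewrite invrN mulNr mulVf ?lt_eqF // subrr.
  rewrite mem_cat => /orP[/ZP[kC _]|]; first exact: Csupp.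
  case/allpairsP => -[l u] /= [/QP[lC l0] /PP[uC u0] ->].
  by rewrite !mxE !Csupp // !mulr0 addr0.
move=> xi; apply/negP => /allP satxi.
pose bound k := slack k xi / coef k.
have [l u lQ uP|t [tQ tP]] := @separating_point R _ bound (fun k => k.2) Q P.
  have /satxi : pair l u \in Z ++ [seq pair l u | l <- Q, u <- P].
    by rewrite mem_cat allpairs_f ?orbT.
  rewrite /sat slack_comb invrN mulNr /= orbC.
  by rewrite lteifBrDr add0r /bound ![_^-1 * _]mulrC.
apply/negP: (infeas (xi + t *: delta_mx o 0)); rewrite negbK; apply/allP => k kC.
rewrite /sat slack_shift -/(coef k) lteifBrDr add0r.
case: (ltgtP (coef k) 0) => k0.
- by rewrite -lteif_ndivrMr // tQ // mem_filter k0.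
- by rewrite -lteif_pdivlMr // tP // mem_filter k0.
by rewrite k0 mulr0; apply: satxi; rewrite mem_cat mem_filter k0 eqxx kC.
Qed.

(** Linear programming duality for a maximum over the polyhedron of a minimum
    over finitely many points. The hypothesis says that the system
    [T *m xi <= d], [dotp xi (Y i) > v] is infeasible, so its constraints combine
    into a contradiction. If the multipliers [mu] of the strict inequalities
    vanish, the contradiction refutes [T *m xi <= d] alone, which is feasible;
    otherwise dividing all multipliers by the sum of [mu] gives the claim. *)
Lemma minimax_duality (R : realType) n q (I : finType) (Y : I -> 'cV[R]_n)
    (T : 'M[R]_(q, n)) (d : 'cV[R]_q) (v : R) :
  polyhedron T d !=set0 ->
  (forall xi, polyhedron T d xi -> exists i, dotp xi (Y i) <= v) ->
  exists mu lam, [/\ forall i : I, 0 <= mu i, \sum_i mu i = 1, vec_le 0 lam,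
    T^T *m lam = \sum_i mu i *: Y i & dotp d lam <= v].
Proof.
move=> [xi0 Xi0] minv.
(* The strictness flag records whether some strict inequality takes part. *)
pose K (k : constraint R n) := exists lam mu, [/\ vec_le 0 lam,
  forall i : I, 0 <= mu i,
  k.1.1 = T^T *m lam - \sum_i mu i *: Y i,
  k.1.2 = dotp d lam - v * \sum_i mu i
  & k.2 = (0 < \sum_i mu i)].
pose C : seq (constraint R n) :=
  [seq ((row j T)^T, d j 0, false) | j : 'I_q] ++
  [seq (- Y i, - v, true) | i : I].
have [||xi|k [[lam [mu [lam0 mu0 k1 k2 k3]]] k10 ksat]] :=
  @fourier_motzkin R n K C.
- move=> s t k l s0 t0 [lam [mu [lam0 mu0 k1 k2 k3]]].
  move=> [lam' [mu' [lam0' mu0' l1 l2 l3]]].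
  have sumE : \sum_i (s * mu i + t * mu' i) =
              s * (\sum_i mu i) + t * (\sum_i mu' i).
    by rewrite !mulr_sumr -big_split.
  exists (s *: lam + t *: lam'), (fun i => s * mu i + t * mu' i); split=> /=.
  + move=> i; rewrite !mxE; have := lam0 i; have := lam0' i; rewrite !mxE.
    by move=> ? ?; rewrite addr_ge0 // mulr_ge0 // ltW.
  + by move=> i; rewrite addr_ge0 // mulr_ge0 // ltW.
  + rewrite k1 l1 mulmxDr -!scalemxAr !scalerBr !scaler_sumr addrACA -opprD.
    rewrite -big_split; congr (_ - _); apply: eq_bigr => i _.
    by rewrite !scalerA scalerDl.
  + by rewrite k2 l2 sumE dotpDr !dotpZr; ring.
  rewrite k3 l3 sumE.
  have S0 : 0 <= \sum_i mu i by exact: sumr_ge0.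
  have S0' : 0 <= \sum_i mu' i by exact: sumr_ge0.
  apply/idP/idP => [/orP[] ?|].
  + by rewrite ltr_wpDr ?mulr_ge0 ?mulr_gt0 // ltW.
  + by rewrite ltr_wpDl ?mulr_ge0 ?mulr_gt0 // ltW.
  apply: contraTT; rewrite negb_or -!leNgt => /andP[S S'].
  have -> : \sum_i mu i = 0 by apply/eqP; rewrite eq_le S S0.
  have -> : \sum_i mu' i = 0 by apply/eqP; rewrite eq_le S' S0'.
  by rewrite !mulr0 addr0.
- move=> k; rewrite mem_cat => /orP[] /mapP[j _ ->].
    exists (delta_mx j 0), (fun=> 0); split=> //=.
    + by move=> i; rewrite !mxE ler0n.
    + rewrite big1 ?subr0 => [|i _]; last by rewrite scale0r.
      by rewrite tr_row colE.
    + by rewrite big1 // mulr0 subr0 dotp_delta.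
    by rewrite big1 // ltxx.
  exists 0, (fun i => (i == j)%:R); split=> //=.
  + rewrite mulmx0 sub0r (bigD1 j) //= eqxx scale1r big1 ?addr0 // => i.
    by move=> /negPf ->; rewrite scale0r.
  + rewrite dotp0 sub0r (bigD1 j) //= eqxx big1 ?addr0 ?mulr1 // => i.
    by move=> /negPf ->.
  by rewrite (bigD1 j) //= eqxx big1 ?addr0 ?ltr01 // => i /negPf ->.
- apply/negP => /allP satxi.
  have Xi : polyhedron T d xi.
    move=> j; have /satxi : ((row j T)^T, d j 0, false) \in C.
      by rewrite mem_cat map_f ?mem_enum.
    by rewrite /sat /slack /= /dotp trmxK -row_mul mxE subr_ge0.
  have [i iv] := minv _ Xi.
  have /satxi : (- Y i, - v, true) \in C.
    by rewrite mem_cat map_f ?mem_enum ?orbT.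
  rewrite /sat /slack /= -[- Y i]scaleN1r dotpZl dotpC subr_gt0.
  by lra.
have Tlam : T^T *m lam = \sum_i mu i *: Y i by apply/eqP; rewrite -subr_eq0 -k1 k10.
have := ksat; rewrite /sat /slack dotp0 subr0 k2 k3.
have := sumr_ge0 _ (fun i _ => mu0 i) : 0 <= \sum_i mu i.
rewrite le_eqVlt => /predU1P[/esym sum0|sum0].
  rewrite sum0 ltxx /= mulr0 subr0 -ltNge => dlam; exfalso.
  have mu_0 i : mu i = 0 by move/psumr_eq0P: sum0; exact.
  have := dotp_le2l Xi0 lam0; rewrite -dotp_mulmx Tlam big1 => [|i _].
    by rewrite dotp0 leNgt dlam.
  by rewrite mu_0 scale0r.
rewrite sum0 /= -leNgt => dlam.
have inv0 := sum0; rewrite -invr_gt0 in inv0.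
exists (fun i => (\sum_i mu i)^-1 * mu i), ((\sum_i mu i)^-1 *: lam); split.
- by move=> i; rewrite mulr_ge0 // ltW.
- by rewrite -mulr_sumr mulVf // gt_eqF.
- move=> i; rewrite !mxE mulr_ge0 ?(ltW inv0) //.
  by have := lam0 i; rewrite mxE.
- by rewrite -scalemxAr Tlam scaler_sumr; apply: eq_bigr => i _; rewrite scalerA.
by rewrite dotpZr ler_pdivrMl // mulrC -subr_le0.
Qed.

(** * Walks and flows in a decision diagram *)

Section Diagram.
Context (R : realType) (n : nat) (D : decision_diagram n).
Hypothesis n_gt0 : (0 < n)%N.
Implicit Types (u v : dd_node D) (a : dd_arc D) (p : seq (dd_arc D)).
Implicit Types (z : 'cV[R]_#|dd_arc D|) (i : 'I_n).

Lemma layer_root : dd_layer (dd_root D) = 0%N :> nat.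
Proof. by rewrite (proj2 (dd_first_layer _)). Qed.

Lemma layer_terminal : dd_layer (dd_terminal D) = n :> nat.
Proof. by rewrite (proj2 (dd_last_layer _)). Qed.

Lemma terminal_neq_root : dd_terminal D != dd_root D.
Proof.
apply/eqP => /(congr1 (fun v => dd_layer v : nat)).
by rewrite layer_root layer_terminal => n0; move: n_gt0; rewrite {1}n0.
Qed.

Lemma head_neq_tail a : dd_head a != dd_tail a.
Proof.
apply/eqP => /(congr1 (fun v => dd_layer v : nat)); rewrite dd_arc_layer => /eqP.
by rewrite eqn_leq ltnn.
Qed.

Lemma walk_rcons u p a :
  dd_walk u p (dd_tail a) -> dd_walk u (rcons p a) (dd_head a).
Proof. by elim: p u => [|b p IH] u /= => [->|[<- /IH]]. Qed.

Lemma walk_layer u p v :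
  dd_walk u p v -> dd_layer v = (dd_layer u + size p)%N :> nat.
Proof.
elim: p u => [|a p IH] u /= => [->|[<- /IH ->]]; first by rewrite addn0.
by rewrite dd_arc_layer addSnnS.
Qed.

Lemma walk_telescope (phi : dd_node D -> R) u p v : dd_walk u p v ->
  \sum_(a <- p) (phi (dd_head a) - phi (dd_tail a)) = phi v - phi u.
Proof.
elim: p u => [|a p IH] u /= => [->|[<- /IH]]; first by rewrite big_nil subrr.
by rewrite big_cons => ->; rewrite addrC subrKA.
Qed.

(** Each arc moves one layer forward, so a walk leaves exactly once each layer
    between its ends. *)
Lemma walk_layer_count u p v k : dd_walk u p v ->
  count (fun a => dd_layer (dd_tail a) == k :> nat) p =
  (dd_layer u <= k < dd_layer v)%N.
Proof.
elim: p u => [|a p IH] u /= => [->|[<- w]].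
  by rewrite leqNgt andNb.
rewrite (IH _ w) (walk_layer w) dd_arc_layer eq_sym.
by case: ltngtP => //= <-; rewrite addSn ltnS leq_addr.
Qed.

Lemma path_vecE p i : dd_rt_path p ->
  dd_path_vec R p i 0 = \sum_(a <- p) (a \in dd_arcs D i true)%:R.
Proof.
move=> rt; have -> : \sum_(a <- p) (a \in dd_arcs D i true)%:R =
    (count (mem (dd_arcs D i true)) p)%:R :> R.
  elim: p {rt} => [|a p IH]; first by rewrite big_nil.
  by rewrite big_cons IH /= natrD.
have : (count (mem (dd_arcs D i true)) p <= 1)%N.
  rewrite (@leq_trans (dd_layer (dd_root D) <= i < dd_layer (dd_terminal D))%N) ?leq_b1 //.
  by rewrite -(walk_layer_count i rt); apply: sub_count => a; rewrite /= inE => /andP[].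
by rewrite mxE has_count; case: count => [|[]].
Qed.

Lemma path_vec_ge0 p i : 0 <= dd_path_vec R p i 0.
Proof. by rewrite mxE ler0n. Qed.

Lemma path_vec_le1 p i : dd_path_vec R p i 0 <= 1.
Proof. by rewrite mxE lern1 leq_b1. Qed.

Lemma path_vec_eq0 p i :
  {in p, forall a, a \notin dd_arcs D i true} -> dd_path_vec R p i 0 = 0.
Proof. by move=> /hasPn /negPf pN; rewrite mxE pN. Qed.

Lemma path_vec_eq1 p i : dd_rt_path p ->
  {in p, forall a, a \notin dd_arcs D i false} -> dd_path_vec R p i 0 = 1.
Proof.
move=> /(walk_layer_count i); rewrite layer_root layer_terminal ltn_ord /= => c1.
have /hasP[a ap /eqP ai] : has (fun a => dd_layer (dd_tail a) == i :> nat) p.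
  by rewrite has_count c1.
move=> /(_ _ ap); rewrite inE ai eqxx /= eqbF_neg negbK => la.
rewrite mxE (_ : has _ _) //; apply/hasP; exists a => //.
by rewrite /= inE ai la !eqxx.
Qed.

(** Under these costs, the cost of a path or of a unit flow is the linear cost
    [dotp xi] of the vector that it induces. *)
Definition arc_cost (xi : 'cV[R]_n) a : R :=
  \sum_i xi i 0 * (a \in dd_arcs D i true)%:R.

Lemma path_cost xi p : dd_rt_path p ->
  dotp xi (dd_path_vec R p) = \sum_(a <- p) arc_cost xi a.
Proof.
move=> rt; rewrite dotpE exchange_big; apply: eq_bigr => i _.
by rewrite path_vecE // mulr_sumr.
Qed.

Lemma flow_cost xi (y : 'cV[R]_n) z :
  (forall i, y i 0 = \sum_(a in dd_arcs D i true) z (enum_rank a) 0) ->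
  dotp xi y = \sum_a z (enum_rank a) 0 * arc_cost xi a.
Proof.
move=> yz; rewrite dotpE.
under [RHS]eq_bigr do rewrite mulr_sumr.
rewrite exchange_big; apply: eq_bigr => i _.
rewrite yz big_mkcond mulr_sumr; apply: eq_bigr => a _.
by case: ifP => _; rewrite ?mulr1 ?mulr0 // mulrC.
Qed.

Lemma incidenceE z v : (dd_incidence R D *m z) (enum_rank v) 0 =
  \sum_a z (enum_rank a) 0 * ((v == dd_head a)%:R - (v == dd_tail a)%:R).
Proof.
rewrite mxE (reindex enum_rank) /=; last exact/onW_bij/enum_rank_bij.
apply: eq_bigr => a _; rewrite mxE !enum_rankK mulrC; congr (_ * _).
case: (eqVneq v (dd_tail a)) => [->|_].
  by rewrite eq_sym (negPf (head_neq_tail a)) sub0r.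
by rewrite subr0; case: eqP.
Qed.

Lemma supplyE v : dd_supply R D (enum_rank v) 0 =
  (v == dd_terminal D)%:R - (v == dd_root D)%:R.
Proof.
rewrite mxE enum_rankK; case: (eqVneq v (dd_root D)) => [->|_].
  by rewrite eq_sym (negPf terminal_neq_root) sub0r.
by rewrite subr0; case: eqP.
Qed.

(** The scalar product of the conservation equations with the potential [phi]. *)
Lemma flow_potential z (phi : dd_node D -> R) :
  dd_incidence R D *m z = dd_supply R D ->
  \sum_a z (enum_rank a) 0 * (phi (dd_head a) - phi (dd_tail a)) =
  phi (dd_terminal D) - phi (dd_root D).
Proof.
have pick u : phi u = \sum_v phi v * (v == u)%:R.
  by rewrite (bigD1 u) //= eqxx mulr1 big1 ?addr0 // => v /negPf ->; rewrite mulr0.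
have pickB u w : phi u - phi w = \sum_v phi v * ((v == u)%:R - (v == w)%:R).
  by rewrite (pick u) (pick w) -sumrB; apply: eq_bigr => v _; rewrite mulrBr.
move=> Az; rewrite [RHS]pickB.
under eq_bigr do rewrite pickB mulr_sumr.
rewrite exchange_big; apply: eq_bigr => v _.
rewrite -supplyE -Az incidenceE mulr_sumr; apply: eq_bigr => a _.
by rewrite mulrCA.
Qed.

Section Flow.
Variable z : 'cV[R]_#|dd_arc D|.
Hypothesis z_ge0 : vec_le 0 z.
Hypothesis z_flow : dd_incidence R D *m z = dd_supply R D.

Let f a := z (enum_rank a) 0.

Let f_ge0 a : 0 <= f a.
Proof. by have := z_ge0 (enum_rank a); rewrite mxE. Qed.

(** The total flow leaving a layer is one unit: this is [flow_potential] for the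
    indicator of the nodes beyond layer [i]. *)
Lemma layer_flow i :
  \sum_(a in dd_arcs D i true) f a + \sum_(a in dd_arcs D i false) f a = 1.
Proof.
have := flow_potential (fun v => (i < dd_layer v)%:R) z_flow.
rewrite layer_root layer_terminal ltn_ord ltn0 subr0 mulr1n => <-.
rewrite (big_mkcond (mem (dd_arcs D i true))) (big_mkcond (mem (dd_arcs D i false))).
rewrite -big_split; apply: eq_bigr => a _ /=.
rewrite !inE dd_arc_layer ltnS (leq_eqVlt i) eq_sym.
by case: ltngtP => _; case: dd_label => /=; rewrite ?subrr ?subr0 ?mulr0 ?mulr1 ?addr0 ?add0r.
Qed.

Lemma inflow_pos v : v != dd_root D ->
  (v = dd_terminal D \/ exists2 a, 0 < f a & dd_tail a = v) ->
  exists2 a, 0 < f a & dd_head a = v.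
Proof.
move=> vr vt; apply: contrapT => noin.
have in0 a : f a * ((v == dd_head a)%:R) = 0.
  case: eqP => [va|]; rewrite ?mulr0 // mulr1; apply/eqP.
  rewrite eq_le f_ge0 andbT leNgt; apply/negP => fa; apply: noin.
  by exists a.
have := congr1 (fun b : 'cV_ _ => b (enum_rank v) 0) z_flow.
rewrite incidenceE supplyE (negPf vr) subr0.
under eq_bigr do rewrite mulrBr in0 sub0r.
rewrite sumrN => out.
case: vt => [vt|[a fa av]].
  have : 0 <= \sum_a f a * (v == dd_tail a)%:R.
    by apply: sumr_ge0 => a _; rewrite mulr_ge0 ?ler0n.
  by rewrite -oppr_le0 out vt eqxx ler10.
have : 0 < \sum_a f a * (v == dd_tail a)%:R.
  rewrite (bigD1 a) //= av eqxx mulr1 ltr_wpDr //.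
  by apply: sumr_ge0 => b _; rewrite mulr_ge0 ?ler0n.
by rewrite -oppr_lt0 out ltrn0.
Qed.

(** Let [phi v] be the least cost of a walk from the root to [v] in the support
    of the flow. Every arc of the support satisfies
    [phi (dd_head a) - phi (dd_tail a) <= w a], so summing against the flow
    gives [phi (dd_terminal D) <= \sum_a f a * w a]. *)
Lemma cheap_support_path (w : dd_arc D -> R) : exists p, [/\ dd_rt_path p,
  {in p, forall a, 0 < f a} & \sum_(a <- p) w a <= \sum_a f a * w a].
Proof.
pose supp_walk v p := dd_walk (dd_root D) p v /\ {in p, forall a, 0 < f a}.
pose reach v := exists p, supp_walk v p.
have reach_head a : 0 < f a -> reach (dd_tail a) -> reach (dd_head a).
  move=> fa [p [wp pp]]; exists (rcons p a); split; first exact: walk_rcons.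
  by move=> b; rewrite mem_rcons inE => /predU1P[-> //|/pp].
(* By flow conservation, flow can be traced back one layer at a time. *)
have reach_tail a : 0 < f a -> reach (dd_tail a).
  move Ek : (dd_layer (dd_tail a) : nat) => k.
  elim: k a Ek => [|k IH] a ak fa.
    exists [::]; split=> //=; symmetry; apply/dd_first_layer; exact: val_inj.
  have ar : dd_tail a != dd_root D.
    by apply/eqP => ar; move: ak; rewrite ar layer_root.
  have [|e fe ea] := inflow_pos ar; first by right; exists a.
  rewrite -ea; apply/reach_head/IH => //.
  by apply/succn_inj; rewrite -dd_arc_layer ea.
have reach_terminal : reach (dd_terminal D).
  have [e fe <-] := @inflow_pos _ terminal_neq_root (or_introl erefl).
  exact/reach_head/reach_tail.
have [phi phiP] : exists phi : dd_node D -> R, forall v, reach v ->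
    (exists2 p, supp_walk v p & \sum_(a <- p) w a = phi v) /\
    (forall p, supp_walk v p -> phi v <= \sum_(a <- p) w a).
  suff /choice[phi phiP] : forall v, exists c, reach v ->
    (exists2 p, supp_walk v p & \sum_(a <- p) w a = c) /\
    (forall p, supp_walk v p -> c <= \sum_(a <- p) w a) by exists phi.
  move=> v; have [rv|nrv] := pselect (reach v); last by exists 0.
  (* The length of a walk to [v] is fixed by the layer of [v], so only finitely
     many walks compete and the minimum is attained. *)
  pose W := [seq p : seq _ <- [seq val t | t : (dd_layer v).-tuple (dd_arc D)]
              | `[< supp_walk v p >] ].
  have WP p : (p \in W) <-> supp_walk v p.
    rewrite mem_filter; split=> [/andP[/asboolP] //|sp]; apply/andP; split.
      exact/asboolP.
    have sz : size p == dd_layer v.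
      by rewrite (walk_layer sp.1) layer_root.
    by apply/mapP; exists (Tuple sz); rewrite ?mem_enum.
  have [|p /WP sp pmin] := @seq_max R _ (fun p => - \sum_(a <- p) w a) W.
    by have [p /WP] := rv; case: W {WP}.
  exists (\sum_(a <- p) w a) => _; split; first by exists p.
  by move=> p' /WP /pmin; rewrite lerN2.
have [[p [wp pp] pphi] _] := phiP _ reach_terminal.
exists p; split=> //.
have phi_root : phi (dd_root D) = 0.
  have rr : supp_walk (dd_root D) [::] by [].
  have [[s [ws _] <-] _] := phiP _ (ex_intro _ _ rr).
  have := walk_layer ws; rewrite layer_root => /esym/eqP; rewrite add0n size_eq0.
  by move=> /eqP ->; rewrite big_nil.
rewrite pphi -[phi _]subr0 -[in X in _ - X]phi_root -(flow_potential phi z_flow).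
apply: ler_sum => a _; rewrite -/(f a).
have := f_ge0 a; rewrite le_eqVlt => /predU1P[<-|fa]; first by rewrite !mul0r.
rewrite ler_pM2l // lerBlDl.
have [[s [ws sf] sphi] _] := phiP _ (reach_tail _ fa).
have [_ /(_ (rcons s a))] := phiP _ (reach_head _ fa (reach_tail _ fa)).
rewrite -cats1 big_cat big_seq1 /= sphi cats1; apply; split.
  exact: walk_rcons.
by move=> b; rewrite mem_rcons inE => /predU1P[-> //|/sf].
Qed.

(** When [y i 0] is extreme, one of the two labels carries no flow out of layer
    [i], so no path in the support uses it there. *)
Lemma support_path_vec (y : 'cV[R]_n) p i :
  y i 0 = \sum_(a in dd_arcs D i true) f a ->
  dd_rt_path p -> {in p, forall a, 0 < f a} ->
  (y i 0 <= 0 -> dd_path_vec R p i 0 = 0) /\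
  (1 <= y i 0 -> dd_path_vec R p i 0 = 1).
Proof.
have no_arc (B : {set dd_arc D}) : {in p, forall a, 0 < f a} ->
    \sum_(a in B) f a <= 0 -> {in p, forall a, a \notin B}.
  move=> pf B0 a /pf fa; apply/negP => aB; move: B0; rewrite leNgt.
  by rewrite (bigD1 a) //= ltr_wpDr ?sumr_ge0.
move=> yi rt pf; split=> [y0|y1].
  by apply: path_vec_eq0; apply: no_arc => //; rewrite -yi.
apply: path_vec_eq1 => //; apply: no_arc => //.
by have := layer_flow i; rewrite -yi; lra.
Qed.

End Flow.

(** The flow sends the amount [mu t] along the path [P t]. Conservation holds
    because the sum of a potential difference along a walk telescopes. *)
Lemma path_flow (I : finType) (mu : I -> R) (P : I -> seq (dd_arc D))
    (z := \col_k \sum_t mu t * (count_mem (enum_val k) (P t))%:R) :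
  (forall t, dd_rt_path (P t)) -> \sum_t mu t = 1 ->
  dd_incidence R D *m z = dd_supply R D /\
  forall i, (\sum_t mu t *: dd_path_vec R (P t)) i 0 =
            \sum_(a in dd_arcs D i true) z (enum_rank a) 0.
Proof.
move=> rt mu1.
have zsum (g : dd_arc D -> R) : \sum_a z (enum_rank a) 0 * g a =
    \sum_t mu t * \sum_(a <- P t) g a.
  under eq_bigr => a _.
    rewrite mxE enum_rankK mulr_suml.
    under eq_bigr do rewrite -mulrA.
    over.
  rewrite exchange_big; apply: eq_bigr => t _; rewrite -mulr_sumr; congr (_ * _).
  elim: (P t) => [|b s IH]; first by rewrite big_nil big1 // => a _; rewrite mul0r.
  rewrite big_cons -IH /=.
  under eq_bigr do rewrite natrD mulrDl.
  rewrite big_split (bigD1 b) //= eqxx mul1r big1 ?addr0 // => a.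
  by rewrite eq_sym => /negPf ->; rewrite mul0r.
split.
  apply/colP => k; rewrite -(enum_valK k) incidenceE zsum supplyE.
  under eq_bigr do rewrite (walk_telescope (fun u => (enum_val k == u)%:R) (rt _)).
  by rewrite -mulr_suml mu1 mul1r.
move=> i; rewrite summxE.
under eq_bigr do rewrite mxE path_vecE //.
rewrite -zsum [RHS]big_mkcond; apply: eq_bigr => a _.
by case: ifP; rewrite ?mulr1 ?mulr0.
Qed.

End Diagram.

(** * Equivalence of the two problems *)

(** Allowing [v = -oo] makes the lemma also show that such an infimum is never
    [-oo]; the condition [v < +oo] excludes the infimum of the empty set. *)
Lemma finite_inf_attained (R : realType) (I : finType) (f : I -> R)
    (A : set (\bar R)) (v : \bar R) :
  (forall s, A s -> exists i, s = (f i)%:E) ->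
  (v < +oo)%E -> (ereal_inf A <= v)%E -> exists i, ((f i)%:E <= v)%E.
Proof.
move=> Af voo; apply: contraPP => nf; apply/negP; rewrite -ltNge.
apply: (@lt_le_trans _ _ (\big[Order.min/+oo%E]_i (f i)%:E)%E).
  apply: lt_bigmin => // i _; rewrite ltNge; apply/negP => fi.
  by apply: nf; exists i.
by apply: le_ereal_inf_tmp => _ /Af[i ->]; exact: bigmin_le.
Qed.

Section Reformulation.
Context (R : realType) (m n p q : nat) (c : 'cV[R]_m) (X : set 'cV[R]_m)
  (G : 'M[R]_(p, n)) (h : 'cV[R]_p) (T : 'M[R]_(q, n)) (d : 'cV[R]_q)
  (U1 U2 U3 : {set 'I_n * 'I_m}) (D : decision_diagram n).
Hypothesis n_gt0 : (0 < n)%N.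
Hypothesis X_binary : X `<=` @binary_vec R m.
Hypothesis Xi_nonempty : polyhedron T d !=set0.
Hypothesis D_represents : dd_represents D (recourse_set G h).

Local Notation Y := (recourse_set G h).
Local Notation S := (adaptable_set U1 U2 U3).
Local Notation worst_case := (worst_case_value c (polyhedron T d) Y S).
Local Notation feasible := (flow_feasible X T S).

(** For each value of [x j 0], a bound of [S x] either holds for all 0/1 vectors
    or forces [y i 0] to an extreme value, which [support_path_vec] passes on to
    the path. *)
Lemma support_path_adaptable x y (z : 'cV[R]_#|dd_arc D|) lam s :
  feasible x y z lam -> dd_rt_path s ->
  {in s, forall a, 0 < z (enum_rank a) 0} -> S x (dd_path_vec R s).
Proof.
move=> [_ yz Az [S1 S2 S3] [/X_binary xb z0 _]] rt sz.
have supp i := support_path_vec n_gt0 z0 Az (yz i) rt sz.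
split=> i j ij; case: (xb j) => xj; rewrite xj.
- by rewrite (supp i).1 // -xj; exact: S1.
- exact: path_vec_le1.
- by rewrite (supp i).1 // -xj; rewrite (S2 i j).
- by rewrite (supp i).2 // -xj; rewrite (S2 i j).
- exact: path_vec_ge0.
- by rewrite (supp i).2 // -xj; exact: S3.
Qed.

(** A cheap path in the support is a recourse decision that does at least as
    well against [xi] as the flow; weak duality then bounds the flow by [lam]. *)
Lemma worst_case_le_flow x y (z : 'cV[R]_#|dd_arc D|) lam :
  feasible x y z lam -> (worst_case x <= (dotp c x + dotp d lam)%:E)%E.
Proof.
move=> feas; have [Ty yz Az _ [_ z0 lam0]] := feas.
apply: ge_ereal_sup => _ [xi Xi <-].
have [s [rt sz cost]] := cheap_support_path n_gt0 z0 Az (arc_cost (D := D) xi).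
apply: ge_ereal_inf; exists (dotp c x + dotp xi (dd_path_vec R s))%:E.
  exists (dd_path_vec R s) => //; split; first exact: D_represents.1.
  exact: (support_path_adaptable feas).
rewrite lee_fin lerD2l path_cost //; apply: (le_trans cost).
by rewrite -(flow_cost xi yz) -Ty dotp_mulmx; exact: dotp_le2l.
Qed.

(** Root-terminal paths have length [n], so these form a finite type; it indexes
    the elements of [Y `&` S x], possibly with repetitions. *)
Definition adaptable_path x := {t : n.-tuple (dd_arc D) |
  `[< dd_rt_path t /\ S x (dd_path_vec R t) >] }.

Lemma adaptable_pathP x (t : adaptable_path x) :
  dd_rt_path (val t) /\ S x (dd_path_vec R (val t)).
Proof. by have /asboolP := valP t. Qed.

Lemma second_stage_path x xi v : (v < +oo)%E ->
  (second_stage_value c Y S x xi <= v)%E -> exists t : adaptable_path x,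
    ((dotp c x + dotp xi (dd_path_vec R (val t)))%:E <= v)%E.
Proof.
apply: finite_inf_attained => _ [y [Yy Sy] <-].
have [s rt sy] := D_represents.2 _ Yy.
have sn : size s == n.
  by have := walk_layer rt; rewrite layer_root layer_terminal => /esym/eqP.
have tP : `[< dd_rt_path (Tuple sn) /\ S x (dd_path_vec R (Tuple sn)) >].
  by apply/asboolP; rewrite /= sy.
by exists (Sub (Tuple sn) tP); rewrite /= sy.
Qed.

Lemma adaptable_set_convex (I : finType) (mu : I -> R) (V : I -> 'cV[R]_n) x :
  (forall t, 0 <= mu t) -> \sum_t mu t = 1 -> (forall t, S x (V t)) ->
  S x (\sum_t mu t *: V t).
Proof.
move=> mu0 mu1 SV.
have xE j : x j 0 = \sum_t mu t * x j 0 by rewrite -mulr_suml mu1 mul1r.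
have yE i : (\sum_t mu t *: V t) i 0 = \sum_t mu t * V t i 0.
  by rewrite summxE; apply: eq_bigr => t _; rewrite mxE.
split=> i j ij; rewrite yE xE.
- by apply: ler_sum => t _; rewrite ler_wpM2l //; have [+ _ _] := SV t; exact.
- by apply: eq_bigr => t _; have [_ /(_ _ _ ij) -> _] := SV t.
- by apply: ler_sum => t _; rewrite ler_wpM2l //; have [_ _ +] := SV t; exact.
Qed.

(** Duality turns the bound on the worst case into one convex combination of
    adaptable paths, which is then read as a flow. *)
Lemma flow_le_worst_case x v : X x -> (worst_case x <= v%:E)%E ->
  exists y (z : 'cV[R]_#|dd_arc D|) lam,
    feasible x y z lam /\ dotp c x + dotp d lam <= v.
Proof.
move=> Xx /ereal_supP wv.
have [xi Xi|mu [lam [mu0 mu1 lam0 Tlam dlam]]] :=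
  @minimax_duality R n q (adaptable_path x) (fun t => dd_path_vec R (val t)) T d
    (v - dotp c x) Xi_nonempty.
  have [|t] := @second_stage_path x xi v%:E (ltry v).
    by apply: wv; exists xi.
  by rewrite lee_fin => tv; exists t; rewrite lerBrDl.
have rt t := (adaptable_pathP (x := x) t).1.
have [Az yz] := path_flow n_gt0 rt mu1.
do 3 eexists; split; last by rewrite -lerBrDl; exact: dlam.
split; [exact: Tlam|exact: yz|exact: Az| |split=> //].
  by apply: adaptable_set_convex => // t; exact: (adaptable_pathP t).2.
by move=> k; rewrite !mxE; apply: sumr_ge0 => t _; rewrite mulr_ge0 ?ler0n.
Qed.

Lemma worst_case_neqNy x : worst_case x <> -oo%E.
Proof.
move=> wN; have [xi Xi] := Xi_nonempty.
have [|//|] := @second_stage_path x xi -oo%E => //.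
by rewrite -wN; apply: ereal_sup_ubound; exists xi.
Qed.

Lemma robust_value_flow :
  robust_value c X (polyhedron T d) Y S = flow_value c X T d S D.
Proof.
apply/le_anti/andP; split.
  apply: le_ereal_inf_tmp => _ [x [y [z [lam [feas ->]]]]].
  apply: ge_ereal_inf; exists (worst_case x); last exact: worst_case_le_flow feas.
  by exists x => //; have [_ _ _ _ []] := feas.
apply: le_ereal_inf_tmp => _ [x Xx <-].
case E : (worst_case x) => [v||]; rewrite ?leey //; last first.
  by have := worst_case_neqNy E.
have [|y [z [lam [feas le_v]]]] := @flow_le_worst_case x v Xx; first by rewrite E.
apply: ge_ereal_inf; exists (dotp c x + dotp d lam)%:E; last by rewrite lee_fin.
by exists x, y, z, lam.
Qed.

Lemma robust_optimal_flow :
  robust_optimal c X (polyhedron T d) Y S = flow_optimal c X T d S D.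
Proof.
apply/seteqP; split=> [x [Xx fin opt]|x [y [z [lam [feas opt]]]]].
  have [|y [z [lam [feas le_v]]]] := @flow_le_worst_case x (fine (worst_case x)) Xx.
    by rewrite fineK // opt.
  exists y, z, lam; split=> //; rewrite -robust_value_flow -opt.
  apply/le_anti; rewrite (worst_case_le_flow feas) andbT.
  by rewrite -(fineK (x := worst_case x)) ?lee_fin // opt.
have Xx : X x by have [_ _ _ _ []] := feas.
split=> //; first by rewrite robust_value_flow -opt.
apply/le_anti; rewrite {1}robust_value_flow -opt (worst_case_le_flow feas) /=.
by apply: ereal_inf_lbound; exists x.
Qed.

End Reformulation.

Theorem proposition3 (R : realType) (m n p q : nat)
    (c : 'cV[R]_m) (X : set 'cV[R]_m)
    (G : 'M[R]_(p, n)) (h : 'cV[R]_p)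
    (T : 'M[R]_(q, n)) (d : 'cV[R]_q)
    (U1 U2 U3 : {set 'I_n * 'I_m})
    (D : decision_diagram n)
    (m_gt0 : (0 < m)%N) (n_gt0 : (0 < n)%N)
    (X_binary : X `<=` @binary_vec R m)
    (Xi_nonempty : polyhedron T d !=set0)
    (Xi_bounded : bounded_set (polyhedron T d))
    (U12 : [disjoint U1 & U2]%B) (U13 : [disjoint U1 & U3]%B)
    (U23 : [disjoint U2 & U3]%B)
    (D_represents : dd_represents D (recourse_set G h)) :
  robust_value c X (polyhedron T d) (recourse_set G h)
      (adaptable_set U1 U2 U3)
    = flow_value c X T d (adaptable_set U1 U2 U3) D
  /\
  robust_optimal c X (polyhedron T d) (recourse_set G h)
      (adaptable_set U1 U2 U3)
    = flow_optimal c X T d (adaptable_set U1 U2 U3) D.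
Proof.
by split; [exact: robust_value_flow|exact: robust_optimal_flow].
Qed.
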